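(* Let $X$ and $Y$ be independent random variables with distributions $F$ and $G$, respectively, supported on $[0,\infty)$, and let $H$ be the distribution of the product $XY$. Assume that for some $\alpha>0$, $$\lim_{x\to\infty} e^{\lambda_1 x^\alpha}\overline{F}(x)=\infty\ \text{ for some }\lambda_1>0,\qquad \lim_{x\to\infty} e^{\lambda_2 x^\alpha}\overline{F}(x)=0\ \text{ for some }\lambda_2>0,$$ and $$\lim_{x\to\infty} e^{\lambda_3 x^\alpha}\overline{G}(x)=0\ \text{ for some }\lambda_3>0.$$ Suppose that $F\in\mathcal{OL}$. Then: (1) $H\in\mathcal{OL}$; (2) if $C^*(F,0)=1$, then $H\in\mathcal{L}$; (3) conversely, if $H\in\mathcal{L}$, then $C_*(F,0)=1$.
   Context: For a distribution $V$ (i.e. distribution function), $\overline V=1-V$ denotes its tail. Saying that $F$ and $G$ are supported on $[0,\infty)$ means that they are concentrated on $[0,\infty)$ with tails $\overline F(x)>0$ and $\overline G(x)>0$ for all $x\ge 0$. A distribution $V$ on $(-\infty,\infty)$ belongs to the long-tailed class $\mathcal{L}$ if $\lim_{x\to\infty}\overline V(x-t)/\overline V(x)=1$ for each $t\in(-\infty,\infty)$. For $t>0$ define $$C^*(V,t)=\limsup_{x\to\infty}\frac{\overline V(x-t)}{\overline V(x)},\qquad C_*(V,t)=\liminf_{x\to\infty}\frac{\overline V(x-t)}{\overline V(x)}.$$ A distribution $V$ belongs to the generalized long-tailed class $\mathcal{OL}$ if $C^*(V,t)<\infty$ for each $t>0$. Both $C^*(V,t)$ and $C_*(V,t)$ are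 non-decreasing in $t>0$ and at least $1$; set $C^*(V,0)=\lim_{t\downarrow 0}C^*(V,t)$ and $C_*(V,0)=\lim_{t\downarrow 0}C_*(V,t)$. *)

(* Defs.v *)
From HB Require Import structures.
From mathcomp Require Import all_boot all_order all_algebra.
From mathcomp Require Import all_classical all_reals all_analysis measurable_realfun.

Set Implicit Arguments.
Unset Strict Implicit.
Unset Printing Implicit Defensive.

Import Order.TTheory GRing.Theory Num.Theory.
Import numFieldNormedType.Exports.

Local Open Scope classical_set_scope.
Local Open Scope ring_scope.

(* A distribution is a probability measure V on R; its distribution function
   is x |-> V ]-oo, x]. *)
Definition tail (R : realType) (V : probability R R) (x : R) : R :=
  1 - fine (V `]-oo, x]%classic).

Definition supported_nneg (R : realType) (V : probability R R) : Prop :=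
  V `[0, +oo[%classic = 1%E /\ forall x : R, 0 <= x -> 0 < tail V x.

Definition tail_ratio (R : realType) (V : probability R R) (t x : R) : R :=
  tail V (x - t) / tail V x.

(* The limit forces tail V x != 0 for large x (as y / 0 = 0), hence for all x. *)
Definition long_tailed (R : realType) (V : probability R R) : Prop :=
  forall t : R, tail_ratio V t x @[x --> +oo] --> (1 : R).

Definition Csup (R : realType) (V : probability R R) (t : R) : \bar R :=
  limf_esup (fun x : R => (tail_ratio V t x)%:E) (pinfty_nbhs R).

Definition Cinf (R : realType) (V : probability R R) (t : R) : \bar R :=
  limf_einf (fun x : R => (tail_ratio V t x)%:E) (pinfty_nbhs R).

(* C^*(V, 0) and C_*(V, 0): the limits as t decreases to 0, not the values of
   Csup V and Cinf V at 0. *)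
Definition Csup0 (R : realType) (V : probability R R) : \bar R :=
  lim (Csup V t @[t --> 0^'+]).

Definition Cinf0 (R : realType) (V : probability R R) : \bar R :=
  lim (Cinf V t @[t --> 0^'+]).

(* Positivity of the tail is implicit in the quotient; without it every
   distribution with bounded support would be included, since 0 / 0 = 0. *)
Definition gen_long_tailed (R : realType) (V : probability R R) : Prop :=
  (forall x : R, 0 < tail V x) /\ forall t : R, 0 < t -> (Csup V t < +oo)%E.

Definition independent_RV (d : measure_display) (T : measurableType d)
    (R : realType) (P : probability T R) (X Y : {RV P >-> R}) : Prop :=
  forall A B : set R, measurable A -> measurable B ->
    P (X @^-1` A `&` Y @^-1` B) = (P (X @^-1` A) * P (Y @^-1` B))%E.

(* Main.v *)
Require Import Defs.
From HB Require Import structures.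
From mathcomp Require Import all_boot all_order all_algebra.
From mathcomp Require Import all_classical all_reals all_analysis measurable_realfun.
From mathcomp Require Import ring lra.

(** Write F, G, H for the laws of X, Y, XY and tail V x for V ]x, +oo[.

    The heart of the matter is that XY is large because of values of Y that
    are neither bounded nor comparable with x. For every a, b > 0,
      tail F (a x) + tail G (b x) = o(tail H x)
    ([exp_tail_negligible]). Indeed tail H x >= tail F (x / y) * tail G y for
    each fixed y > 0 ([product_tail_ge]), where tail G y > 0; the first factor is eventually
    above exp (- l1 (x / y)^alpha), and taking y large makes this exponent as
    small a multiple of x^alpha as desired, hence beats the upper bounds
    exp (- l (a x)^alpha) that the tails of F and G obey. So, up to
    o(tail H x), the event XY > x - t may be restricted to A < Y <= x / K with
    A and K arbitrary constants ([product_tail_split]).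

    Given Y = v in that range, the event is X > x / v - t / v with
    x / v >= K large and t / v < t / A small. If A = t / s, then replacing
    x - t by x costs at most the factor M as soon as
    tail F (z - s) <= M * tail F z for z >= K; integrating over v gives
      tail H (x - t) <= (M + e) * tail H x
    for large x ([product_tail_shift]). Hence C^*(H, t) <= C^*(F, s) for all
    s, t > 0. With s = 1 this shows that H is in OL, and letting s tend to 0
    it shows that H is in L when C^*(F, 0) = 1.

    The equality C_*(F, 0) = 1 comes from F being in OL
    ([gen_long_tailed_Cinf0]): C_*(F, 1 / n) > 1 + e would make F gain the
    factor 1 + e over each of n successive steps of length 1 / n, so that
    (1 + e)^n <= C^*(F, 1), which fails for large n. *)

Set Implicit Arguments.
Unset Strict Implicit.
Unset Printing Implicit Defensive.

Import Order.TTheory GRing.Theory Num.Theory.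
Import numFieldNormedType.Exports.

Local Open Scope classical_set_scope.
Local Open Scope ring_scope.

(** * Eventual bounds from upper and lower limits *)

Section limsup_near.
Context {T : choiceType} {X : filteredType T} {R : realType}.
Context (f : X -> \bar R) (F : set_system X) {FF : Filter F} (a : \bar R).
Local Open Scope ereal_scope.

Lemma limf_esup_lt_near : limf_esup f F < a -> \forall x \near F, f x < a.
Proof.
rewrite limf_esupE => /ereal_inf_lt[_ [V FV <-]] supVa.
apply: filterS FV => x Vx; apply: le_lt_trans supVa.
by apply: ereal_sup_ubound; exists x.
Qed.

Lemma near_le_limf_esup : (\forall x \near F, f x <= a) -> limf_esup f F <= a.
Proof.
move=> fa; rewrite limf_esupE; apply: ge_ereal_inf.
exists (ereal_sup (f @` [set x | f x <= a])); first by exists [set x | f x <= a].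
by apply: ge_ereal_sup => _ [x /= fxa <-].
Qed.

End limsup_near.

Section liminf_near.
Context {T : choiceType} {X : filteredType T} {R : realType}.
Context (f : X -> \bar R) (F : set_system X) {FF : Filter F} (a : \bar R).
Local Open Scope ereal_scope.

Lemma lt_limf_einf_near : a < limf_einf f F -> \forall x \near F, a < f x.
Proof.
rewrite /limf_einf lteNr => /limf_esup_lt_near.
by apply: filterS => x; rewrite lteN2.
Qed.

Lemma near_ge_limf_einf : (\forall x \near F, a <= f x) -> a <= limf_einf f F.
Proof.
move=> fa; rewrite /limf_einf leeNr; apply: near_le_limf_esup.
by apply: filterS fa => x; rewrite leeN2.
Qed.

End liminf_near.

Lemma limf_esup_mono (T : choiceType) (X : filteredType T) (R : realType)
    (f g : X -> \bar R) (F : set_system X) : (forall x, (f x <= g x)%E) ->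
  (limf_esup f F <= limf_esup g F)%E.
Proof.
move=> fg; rewrite !limf_esupE; apply: le_ereal_inf_tmp => _ [V FV <-].
apply: ge_ereal_inf; exists (ereal_sup (f @` V)); first by exists V.
apply: ge_ereal_sup => _ [x Vx <-]; apply: le_trans (fg x) _.
by apply: ereal_sup_ubound; exists x.
Qed.

Lemma near_pinfty_affine (R : realType) (Q : R -> Prop) (a b : R) : 0 < a ->
  (\forall x \near +oo, Q x) -> \forall x \near +oo, Q (a * x + b).
Proof.
move=> a0 [M [Mreal MQ]]; exists ((M - b) / a); split; first exact: num_real.
by move=> x; rewrite ltr_pdivrMr// ltrBlDr mulrC => /MQ.
Qed.

(** * Tails and their ratios *)

Lemma lt_pinfty_EFin (R : realType) (a : \bar R) : (a < +oo)%E ->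
  exists2 M : R, 0 <= M & (a < M%:E)%E.
Proof.
case: a => [r _|//|_]; last by exists 0; rewrite ?ltNyr.
exists (`|r| + 1); first by rewrite addr_ge0 ?normr_ge0 ?ler01.
by rewrite lte_fin ltr_pwDr// ler_norm.
Qed.

Lemma expr1D_unbounded (R : realType) (M e : R) : 0 < e ->
  exists2 n : nat, (0 < n)%N & M < (1 + e) ^+ n.
Proof.
move=> e0; exists (Num.truncn (M / e)).+1 => //.
(* Bernoulli's inequality reduces the claim to the archimedean property. *)
apply: (@lt_le_trans _ _ (1 + e *+ (Num.truncn (M / e)).+1)).
  have := truncnS_gt (M / e).
  by rewrite ltr_pdivrMr// mulr_natl => ?; lra.
elim: _.+1 => [|m IHm]; first by rewrite mulr0n addr0.
rewrite exprS mulrS mulrDl mul1r.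
have : e * 1 <= e * (1 + e) ^+ m by rewrite ler_pM2l// exprn_ege1//; lra.
lra.
Qed.

Section tail_theory.
Context {R : realType} (V : probability R R).
Implicit Types x t : R.

Lemma EFin_tail x : (tail V x)%:E = V `]x, +oo[%classic.
Proof.
rewrite /tail EFinB fineK ?fin_num_measure//.
by rewrite -probability_setC// setCitvl.
Qed.

Lemma tail_ge0 x : 0 <= tail V x.
Proof. by rewrite -lee_fin EFin_tail. Qed.

Lemma tail_nonincreasing : nonincreasing_fun (tail V).
Proof.
move=> x y xy; rewrite -lee_fin !EFin_tail; apply: le_measure; rewrite ?inE//.
by apply: subset_itvr; rewrite bnd_simp.
Qed.

Lemma tail_ratio_nondecreasing t u x : t <= u ->
  tail_ratio V t x <= tail_ratio V u x.
Proof.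
move=> tu; rewrite ler_wpM2r ?invr_ge0 ?tail_ge0// tail_nonincreasing//.
by rewrite lerD2l lerN2.
Qed.

Lemma Csup_nondecreasing : {homo Csup V : t u / t <= u >-> (t <= u)%E}.
Proof.
by move=> t u tu; apply: limf_esup_mono => x; rewrite lee_fin
  tail_ratio_nondecreasing.
Qed.

Lemma Cinf_nondecreasing : {homo Cinf V : t u / t <= u >-> (t <= u)%E}.
Proof.
move=> t u tu; rewrite /Cinf /limf_einf leeN2; apply: limf_esup_mono => x.
by rewrite leeN2 lee_fin tail_ratio_nondecreasing.
Qed.

(** The limit at 0 in the definition of [Csup0] exists because [Csup V] is
    nondecreasing, and it is then the infimum over positive arguments; likewise
    for [Cinf0]. *)
Lemma Csup0E : Csup0 V = ereal_inf (Csup V @` `]0, +oo[).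
Proof.
apply/cvg_lim => //; apply: (nondecreasing_at_right_cvge (BInfty _ false)) => //.
by move=> t u _ _; exact: Csup_nondecreasing.
Qed.

Lemma Csup0_lt a : (Csup0 V < a)%E -> exists2 s, 0 < s & (Csup V s < a)%E.
Proof.
rewrite Csup0E => /ereal_inf_lt[_ [s /= + <-]].
by rewrite in_itv/= andbT; exists s.
Qed.

Lemma Cinf0E : Cinf0 V = ereal_inf (Cinf V @` `]0, +oo[).
Proof.
apply/cvg_lim => //; apply: (nondecreasing_at_right_cvge (BInfty _ false)) => //.
by move=> t u _ _; exact: Cinf_nondecreasing.
Qed.

Lemma Csup_lt_near t M : (Csup V t < M%:E)%E ->
  \forall x \near +oo, tail_ratio V t x < M.
Proof. by move/limf_esup_lt_near; apply: filterS => x; rewrite lte_fin. Qed.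

Lemma tail_ratio_ge1 t x : 0 < tail V x -> 0 <= t -> 1 <= tail_ratio V t x.
Proof.
move=> tail_gt0 t0; rewrite /tail_ratio ler_pdivlMr// mul1r.
by apply: tail_nonincreasing; rewrite gerBl.
Qed.

Lemma iter_tail_le t M x0 : 0 < t -> 0 <= M ->
  (forall x, x0 < x -> M * tail V x <= tail V (x - t)) ->
  forall n x, x0 + t * n%:R < x -> M ^+ n * tail V x <= tail V (x - t * n%:R).
Proof.
move=> t0 M0 stepM; elim=> [|n IHn] x; first by rewrite mulr0 subr0 mul1r.
rewrite -natr1 mulrDr mulr1 => x0x; rewrite exprSr -mulrA.
have {}x0x : x0 + t * n%:R < x - t by lra.
have tn : 0 <= t * n%:R by rewrite mulr_ge0// ltW.
apply: le_trans (_ : M ^+ n * tail V (x - t) <= _).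
  by rewrite ler_wpM2l ?exprn_ge0// stepM//; lra.
have := IHn _ x0x; congr (_ <= tail V _); lra.
Qed.

(** Lower ratios are supermultiplicative: n steps of length 1 / n multiply n
    gains of more than 1 + e, while the total shift 1 has a bounded ratio. *)
Lemma gen_long_tailed_Cinf0 : gen_long_tailed V -> Cinf0 V = 1%E.
Proof.
move=> [tail_gt0 Cfin]; rewrite Cinf0E.
apply/eqP; rewrite eq_le; apply/andP; split.
  apply/lee_addgt0Pr => e e0.
  have [M _ CM] := lt_pinfty_EFin (Cfin _ (@ltr01 R)).
  have [n n0 Mn] := expr1D_unbounded M e0.
  apply: ge_ereal_inf; exists (Cinf V n%:R^-1).
    by exists n%:R^-1 => //=; rewrite in_itv/= andbT invr_gt0 ltr0n.
  rewrite leNgt; apply/negP => /lt_limf_einf_near[x0 [_ x0C]].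
  have [x1 [_ x1C]] := Csup_lt_near CM.
  (* The n intermediate points x - k / n all have to stay above x0. *)
  pose x := Num.max (x0 + 1) x1 + 1.
  have xx0 : x0 + 1 < x by rewrite /x ltr_pwDr// le_max lexx.
  have xx1 : x1 < x by rewrite /x ltr_pwDr// le_max lexx orbT.
  have nn : n%:R^-1 * n%:R = 1 :> R by rewrite mulVf// pnatr_eq0 -lt0n.
  have e1 : 0 <= 1 + e by lra.
  have stp y : x0 < y -> (1 + e) * tail V y <= tail V (y - n%:R^-1).
    by move=> /x0C; rewrite lte_fin /tail_ratio ltr_pdivlMr// => /ltW.
  have := iter_tail_le (t := n%:R^-1) _ e1 stp (n := n) (x := x).
  rewrite nn invr_gt0 ltr0n => /(_ n0 xx0).
  have := x1C _ xx1; rewrite /tail_ratio ltr_pdivrMr// => xM.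
  move=> /le_lt_trans/(_ xM); rewrite ltr_pM2r// => /lt_trans/(_ Mn).
  by rewrite ltxx.
apply: le_ereal_inf_tmp => _ [t /= +] <-; rewrite in_itv/= andbT => t0.
by apply: near_ge_limf_einf; near=> x; rewrite lee_fin tail_ratio_ge1// ltW.
Unshelve. all: by end_near. Qed.

End tail_theory.

(** * The tail of a product of independent variables *)

Section product_tail.
Context {d : measure_display} {T : measurableType d} {R : realType}.
Context (P : probability T R) (X Y : {RV P >-> R}).
Hypothesis indepXY : independent_RV X Y.
Implicit Types x t : R.

Let F := distribution P X.
Let G := distribution P Y.
Let H := distribution P (X \* Y)%R.

Lemma measurable_RV_gt (Z : {RV P >-> R}) x : measurable [set w | x < Z w].
Proof.
rewrite (_ : [set w | _] = setT `&` Z @^-1` `]x, +oo[%classic).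
  exact: measurable_funPT.
by apply/seteqP; split => w; rewrite setTI/= in_itv/= andbT.
Qed.

Lemma measurable_RV_lt (Z : {RV P >-> R}) x : measurable [set w | Z w < x].
Proof.
rewrite (_ : [set w | _] = setT `&` Z @^-1` `]-oo, x[%classic).
  exact: measurable_funPT.
by apply/seteqP; split => w; rewrite setTI/= in_itv.
Qed.

Lemma tail_distribution (Z : {RV P >-> R}) x :
  (tail (distribution P Z) x)%:E = P [set w | x < Z w].
Proof.
rewrite EFin_tail; congr (P _).
by apply/seteqP; split => w /=; rewrite in_itv/= andbT.
Qed.

Lemma product_tail_ge x y : 0 < x -> 0 < y ->
  tail F (x / y) * tail G y <= tail H x.
Proof.
move=> x0 y0; rewrite -lee_fin EFinM !EFin_tail.
rewrite -[X in (X <= _)%E](indepXY (measurable_itv _) (measurable_itv _)).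
rewrite -EFin_tail tail_distribution; apply: le_measure; rewrite ?inE//.
- by apply: measurableI; rewrite -[X in measurable X]setTI;
    apply: measurable_funPT.
- exact: measurable_RV_gt.
- move=> w [] /=; rewrite !in_itv/= !andbT => Xx Yy.
  rewrite -(divfK (lt0r_neq0 y0) x).
  by apply: ltr_pM => //; rewrite ltW// divr_gt0.
Qed.

(** By independence the joint law of (Y, X) is the product measure, so a bound
    that holds on every section over a value v of Y survives integration in v. *)
Lemma le_section_product (A B : set (R * R)) (M : R) : 0 <= M ->
  measurable A -> measurable B ->
  (forall v, (F (xsection A v) <= M%:E * F (xsection B v))%E) ->
  (P [set w | A (Y w, X w)] <= M%:E * P [set w | B (Y w, X w)])%E.
Proof.
move=> M0 mA mB AB.
have mYX : measurable_fun setT (fun w => (Y w, X w)).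
  exact: measurable_fun_pair.
pose YX : {mfun T >-> (R * R)%type} := mfun_Sub (mem_set mYX).
have joint C : measurable C ->
    P [set w | C (Y w, X w)] = (\int[G]_v F (xsection C v))%E.
  move=> mC.
  apply/esym.
  apply: (@product_measure_unique _ _ _ _ _ G F (distribution P YX)) => //.
  move=> C1 C2 mC1 mC2; rewrite muleC -indepXY//.
  by congr (P _); apply/seteqP; split => w [].
rewrite !joint// -ge0_integralZl_EFin//; last exact: measurable_fun_xsection.
apply: ge0_le_integral => //.
- exact: measurable_fun_xsection.
- by apply: measurable_funeM; exact: measurable_fun_xsection.
Qed.

(** Dilating the argument by an arbitrary a > 0, even a small one, makes the tail
    of V negligible against that of XY: Y exceeds any fixed y with positive
    probability, and then X > x / y is enough for XY > x, which for large y is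
    more likely than the exponential bound on tail V (a x). *)
Lemma exp_tail_negligible (V : probability R R) (alpha l1 l a e : R) :
  0 < alpha -> 0 < l1 -> 0 < l -> 0 < a -> 0 < e ->
  (forall y, 0 <= y -> 0 < tail G y) ->
  expR (l1 * x `^ alpha) * tail F x @[x --> +oo] --> +oo ->
  expR (l * x `^ alpha) * tail V x @[x --> +oo] --> (0 : R) ->
  \forall x \near +oo, tail V (a * x) <= e * tail H x.
Proof.
move=> alpha0 l10 l0 a0 e0 G0 Foo V0.
(* The value y := c / a of Y is the one that makes the two exponents
   l (a x)^alpha and l1 (x / y)^alpha equal. *)
pose c := (l1 / l) `^ alpha^-1.
have c0 : 0 < c by rewrite powR_gt0// divr_gt0.
have cE : c `^ alpha = l1 / l.
  by rewrite -powRrM mulVf ?gt_eqF// powRr1// ltW// divr_gt0.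
pose y := c / a.
have y0 : 0 < y by rewrite divr_gt0.
have Gy : 0 < tail G y by rewrite G0// ltW.
have yV0 : 0 < y^-1 by rewrite invr_gt0.
have F1 : \forall x \near +oo, 1 <= expR (l1 * x `^ alpha) * tail F x.
  by move/cvgryPge : Foo; exact.
have V1 : \forall x \near +oo, expR (l * x `^ alpha) * tail V x <= e * tail G y.
  have eG : 0 < e * tail G y by rewrite mulr_gt0.
  exact: cvgr_le V0 _ eG.
have {}F1 := near_pinfty_affine 0 yV0 F1.
have {}V1 := near_pinfty_affine 0 a0 V1.
near=> x.
have x0 : 0 < x by [].
have exponentE : l * (a * x) `^ alpha = l1 * (x / y) `^ alpha.
  rewrite (_ : a * x = c * (x / y)); last first.
    by rewrite /y; field; rewrite !gt_eqF.
  rewrite powRM ?cE ?ltW ?divr_gt0//.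
  by field; rewrite gt_eqF.
have : 1 <= expR (l1 * (x / y) `^ alpha) * tail F (x / y).
  by rewrite [x / y]mulrC -[y^-1 * x]addr0; near: x.
have : expR (l * (a * x) `^ alpha) * tail V (a * x) <= e * tail G y.
  by rewrite -[a * x]addr0; near: x.
rewrite exponentE; set E := expR _ => Vx Fx.
have E0 : 0 < E by exact: expR_gt0.
rewrite -(ler_pM2l E0); apply: le_trans Vx _.
apply: (@le_trans _ _ (e * tail G y * (E * tail F (x / y)))).
  by rewrite ler_peMr// mulr_ge0// ltW.
have := product_tail_ge x0 y0.
rewrite -(ler_pM2l E0) -(ler_pM2l e0) => h.
rewrite (_ : _ * _ = e * (E * (tail F (x / y) * tail G y))); last by ring.
by apply: le_trans h _; rewrite mulrCA.
Unshelve. all: by end_near. Qed.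

Lemma nonneg_product_gt (x u v : R) : 0 <= x -> 0 <= u -> x < u * v -> 0 < v.
Proof.
move=> x0 u0 xuv; rewrite ltNge; apply/negP => v0.
have : u * v <= 0 by rewrite mulr_ge0_le0.
by move/(lt_le_trans xuv); rewrite ltNge x0.
Qed.

(** Points are pairs (v, u) of a value v of Y and a value u of X, in this order
    so that the sections at fixed v are those of the product measure G x F. *)
Definition strip (a b z : R) : set (R * R) :=
  [set p | (a < p.1 <= b) /\ z < p.2 * p.1].

Lemma measurable_strip a b z : measurable (strip a b z).
Proof.
rewrite (_ : strip a b z =
    (fst @^-1` `]a, b]%classic) `&` ((snd \* fst) @^-1` `]z, +oo[%classic)).
  apply: measurableI.
    by rewrite -[X in measurable X]setTI; exact: measurable_fst.
  rewrite -[X in measurable X]setTI; apply: measurable_funM => //.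
by apply/seteqP; split => p; rewrite /strip/= !in_itv/= andbT.
Qed.

Let strip_event (a b z : R) : set T := [set w | strip a b z (Y w, X w)].

Let measurable_strip_event a b z : measurable (strip_event a b z).
Proof.
have mYX : measurable_fun setT (fun w => (Y w, X w)).
  exact: measurable_fun_pair.
by have := mYX measurableT _ (measurable_strip a b z); rewrite setTI.
Qed.

(** A product above z >= 0 with a nonnegative factor X forces Y > 0; then either
    Y <= a, whence X > z / a, or Y > b, or Y lies in between. *)
Lemma product_tail_split z a b : 0 <= z -> 0 < a ->
  F `[0, +oo[%classic = 1%E ->
  ((tail H z)%:E <= (tail F (z / a))%:E + (tail G b)%:E +
    P (strip_event a b z))%E.
Proof.
move=> z0 a0 F1.
have X0 : P [set w | X w < 0] = 0%E.
  rewrite (_ : [set w | X w < 0] = X @^-1` `]-oo, 0[%classic); last first.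
    by apply/seteqP; split => w /=; rewrite in_itv.
  have := @probability_setC _ _ _ (distribution P X) _
    (measurable_itv `[(0 : R), +oo[).
  by rewrite setCitvr -/F [X in (_ - X)%E]F1 subee.
rewrite !tail_distribution -[X in (_ <= X + _ + _)%E]add0e -X0.
have mXneg : measurable [set w | X w < 0] by exact: measurable_RV_lt.
have mgt := measurable_RV_gt.
apply: (@le_trans _ _ (P ([set w | X w < 0] `|` [set w | z / a < X w] `|`
  [set w | b < Y w] `|` strip_event a b z))).
  apply: le_measure; rewrite ?inE//.
  - by do 2 apply: measurableU => //; apply: measurableU.
  - move=> w /= zXY.
    have [Xneg|Xpos] := ltP (X w) 0; first by do 3 left.
    have Ypos := nonneg_product_gt z0 Xpos zXY.
    have [Yb|bY] := leP (Y w) b; last by left; right.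
    have [Ya|aY] := leP (Y w) a; last by right; split => /=; rewrite ?aY.
    left; left; right; rewrite /= ltr_pdivrMr//.
    by apply: lt_le_trans zXY _; rewrite ler_wpM2l.
have mU A B : measurable A -> measurable B -> (P (A `|` B) <= P A + P B)%E.
  by move=> mA mB; exact: measureU2.
apply: (le_trans (mU _ _ _ _)) => //.
  by do 2 apply: measurableU => //.
rewrite leeD2r//; apply: (le_trans (mU _ _ _ _)) => //.
  exact: measurableU.
by rewrite leeD2r//; exact: mU.
Qed.

(** On the strip the shift t of the product becomes a shift t / v < s of X at
    the point x / v >= K, which the assumption on F absorbs. *)
Lemma strip_shift s t M K x :
  0 < t -> 0 < s -> 0 < K -> 0 <= M ->
  (forall z, K <= z -> tail F (z - s) <= M * tail F z) ->
  (P (strip_event (t / s) (x / K) (x - t)) <= M%:E * (tail H x)%:E)%E.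
Proof.
move=> t0 s0 K0 M0 FM; set a := t / s.
have a0 : 0 < a by rewrite divr_gt0.
apply: (@le_trans _ _ (M%:E * P (strip_event a (x / K) x))%E); last first.
  rewrite lee_wpmul2l ?lee_fin// tail_distribution.
  apply: le_measure; rewrite ?inE//.
  - exact: measurable_RV_gt.
  - by move=> w [].
apply: le_section_product => //; [exact: measurable_strip..|move=> v].
have secE z : F (xsection (strip a (x / K) z) v) =
    if a < v <= x / K then (tail F (z / v))%:E else 0%E.
  case: ifPn => av.
    rewrite EFin_tail; congr (F _); apply/seteqP; split => u.
      rewrite /xsection/= inE => -[_] /=; rewrite in_itv/= andbT.
      by rewrite ltr_pdivrMr//; case/andP: av => /(lt_trans a0).
    rewrite /xsection/= inE in_itv/= andbT => zu; split => //=.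
    by move: zu; rewrite ltr_pdivrMr//; case/andP: av => /(lt_trans a0).
  rewrite -[RHS](measure0 F); congr (F _); apply/seteqP; split => // u.
  by rewrite /xsection/= inE => -[/=]; rewrite (negbTE av).
rewrite !secE; case: ifPn => [/andP[av vK]|]; last by rewrite mule0.
have v0 := lt_trans a0 av.
rewrite -EFinM lee_fin.
apply: le_trans (FM (x / v) _).
  apply: tail_nonincreasing; rewrite mulrBl lerD2l lerN2.
  by rewrite ler_pdivrMr// mulrC -ler_pdivrMr// ltW.
by rewrite ler_pdivlMr// mulrC -ler_pdivlMr.
Qed.

(** The middle range of Y starts at t / s so that X is shifted by at most s there;
    each of the two outer ranges costs half of e. *)
Lemma product_tail_shift (alpha l1 l2 l3 s t M e : R) :
  0 < alpha -> 0 < l1 -> 0 < l2 -> 0 < l3 ->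
  F `[0, +oo[%classic = 1%E ->
  (forall y, 0 <= y -> 0 < tail G y) ->
  expR (l1 * x `^ alpha) * tail F x @[x --> +oo] --> +oo ->
  expR (l2 * x `^ alpha) * tail F x @[x --> +oo] --> (0 : R) ->
  expR (l3 * x `^ alpha) * tail G x @[x --> +oo] --> (0 : R) ->
  0 < t -> 0 < s -> 0 <= M -> 0 < e ->
  (\forall z \near +oo, tail F (z - s) <= M * tail F z) ->
  \forall x \near +oo, tail H (x - t) <= (M + e) * tail H x.
Proof.
move=> alpha0 l10 l20 l30 F1 G0 Foo F0 G00 t0 s0 M0 e0 [K0 [_ FM]].
pose K := Num.max K0 0 + 1.
have KK0 : K0 < K by rewrite ltr_pwDr// le_max lexx.
have Kpos : 0 < K by rewrite ltr_pwDr// le_max lexx orbT.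
pose a := t / s.
have a0 : 0 < a by rewrite divr_gt0.
have a20 : 0 < (2 * a)^-1 by rewrite invr_gt0 mulr_gt0.
have Kinv : 0 < K^-1 by rewrite invr_gt0.
have e2 : 0 < e / 2 by rewrite divr_gt0.
have small_Y := exp_tail_negligible alpha0 l10 l20 a20 e2 G0 Foo F0.
have large_Y := exp_tail_negligible alpha0 l10 l30 Kinv e2 G0 Foo G00.
near=> x.
(* So that (x - t) / a >= x / (2 a), where the dilation estimate applies. *)
have xt : t * 2 < x by near: x; apply: nbhs_pinfty_gt; exact: num_real.
have xt0 : 0 <= x - t by lra.
have split_x := product_tail_split (x / K) xt0 a0 F1.
have strip_x : (P (strip_event a (x / K) (x - t)) <= M%:E * (tail H x)%:E)%E.
  by apply: strip_shift => // z Kz; apply: FM; exact: lt_le_trans Kz.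
have := le_trans split_x (leeD2l _ strip_x).
rewrite -EFinM -!EFinD lee_fin => /le_trans; apply.
have Fx : tail F ((x - t) / a) <= e / 2 * tail H x.
  apply: (@le_trans _ _ (tail F ((2 * a)^-1 * x))); last by near: x.
  apply: tail_nonincreasing; rewrite invfM mulrAC ler_pM2r ?invr_gt0//; lra.
have Gx : tail G (x / K) <= e / 2 * tail H x by rewrite mulrC; near: x.
lra.
Unshelve. all: by end_near. Qed.

End product_tail.

(** * Long-tailedness of the product *)

(** The limit is needed for positive shifts only: ratios are then at least 1, and
    the ratio for a negative shift is the inverse of one for a positive shift. *)
Lemma long_tailed_near_le (R : realType) (V : probability R R) :
  (forall x, 0 < tail V x) ->
  (forall t e : R, 0 < t -> 0 < e ->
    \forall x \near +oo, tail_ratio V t x <= 1 + e) ->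
  long_tailed V.
Proof.
move=> V0 Vle.
have pos t : 0 < t -> tail_ratio V t x @[x --> +oo] --> (1 : R).
  move=> t0; apply/cvgrPdist_le => e e0; apply: filterS (Vle _ _ t0 e0) => x xe.
  rewrite ler_distlC; have := tail_ratio_ge1 (V0 x) (ltW t0); lra.
move=> t; have [t0|t0|->] := ltgtP t 0; last 2 first.
- exact: pos.
- rewrite (_ : tail_ratio V 0 = cst 1); first exact: cvg_cst.
  by apply/funext => x; rewrite /tail_ratio subr0 divff// gt_eqF.
rewrite (_ : tail_ratio V t = fun x => (tail_ratio V (- t) (x - t))^-1).
  rewrite -[X in _ --> X]invr1; apply: cvgV; first exact: oner_neq0.
  have nt0 : 0 < - t by rewrite oppr_gt0.
  apply/cvgrPdist_le => e e0.
  have /cvgrPdist_le/(_ _ e0) := pos _ nt0.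
  move/(near_pinfty_affine (- t) (@ltr01 R)).
  by apply: filterS => x; rewrite mul1r.
by apply/funext => x; rewrite /tail_ratio invf_div opprK subrK.
Qed.

Theorem theorem1p1 (R : realType) (d : measure_display) (T : measurableType d)
    (P : probability T R) (X Y : {RV P >-> R}) (F G H : probability R R)
    (alpha : R) :
  independent_RV X Y ->
  F = distribution P X -> G = distribution P Y ->
  H = distribution P (X \* Y)%R ->
  supported_nneg F -> supported_nneg G ->
  0 < alpha ->
  (exists2 l1 : R, 0 < l1 &
     expR (l1 * x `^ alpha) * tail F x @[x --> +oo] --> +oo) ->
  (exists2 l2 : R, 0 < l2 &
     expR (l2 * x `^ alpha) * tail F x @[x --> +oo] --> (0 : R)) ->
  (exists2 l3 : R, 0 < l3 &
     expR (l3 * x `^ alpha) * tail G x @[x --> +oo] --> (0 : R)) ->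
  gen_long_tailed F ->
  [/\ gen_long_tailed H,
      Csup0 F = 1%E -> long_tailed H &
      long_tailed H -> Cinf0 F = 1%E].
Proof.
move=> indep -> -> -> [F1 Fpos] [G1 Gpos] alpha0 [l1 l10 Foo] [l2 l20 F0]
  [l3 l30 G0] OLF.
have H0 x : 0 < tail (distribution P (X \* Y)%R) x.
  pose y := Num.max x 1.
  have y0 : 0 < y by rewrite lt_max ltr01 orbT.
  apply: (@lt_le_trans _ _ (tail (distribution P (X \* Y)%R) y)); last first.
    by apply: tail_nonincreasing; rewrite le_max lexx.
  apply: lt_le_trans (product_tail_ge indep y0 (@ltr01 R)).
  by rewrite mulr_gt0 ?Fpos ?Gpos// divr1 ltW.
have shift s t M e : 0 < s -> 0 < t -> 0 <= M -> 0 < e ->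
    (Csup (distribution P X) s < M%:E)%E ->
    \forall x \near +oo, tail_ratio (distribution P (X \* Y)%R) t x <= M + e.
  move=> s0 t0 M0 e0 FM.
  have FsM : \forall z \near +oo, tail (distribution P X) (z - s) <=
      M * tail (distribution P X) z.
    apply: filterS (Csup_lt_near FM) => z.
    by rewrite /tail_ratio ltr_pdivrMr ?OLF.1// => /ltW.
  have := product_tail_shift indep alpha0 l10 l20 l30 F1 Gpos Foo F0 G0
    t0 s0 M0 e0 FsM.
  by apply: filterS => x; rewrite ler_pdivrMr.
split.
- split=> // t t0.
  have [M M0 FM] := lt_pinfty_EFin (OLF.2 _ (@ltr01 R)).
  apply: (@le_lt_trans _ _ (M + 1)%:E); last exact: ltry.
  by apply: near_le_limf_esup; apply: shift FM.
- move=> F01; apply: long_tailed_near_le => // t e t0 e0.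
  have e20 : 0 < e / 2 by rewrite divr_gt0.
  have [s s0 Fs] : exists2 s, 0 < s &
      (Csup (distribution P X) s < (1 + e / 2)%:E)%E.
    by apply: Csup0_lt; rewrite F01 lte_fin ltrDl.
  rewrite [in 1 + e](splitr e) addrA; apply: shift Fs => //.
  by rewrite addr_ge0// ltW.
- by move=> _; exact: gen_long_tailed_Cinf0.
Qed.
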